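(* Let $m\ge1$. For all $n\ge2$, the string $T_n^{(m)}$ is a prefix of the sequence $A^{(m+1)}$, or is all of $A^{(m+1)}$ if $T_n^{(m)}$ is infinite.
   Context: Strings may be finite or infinite. For a nonempty finite string $U$ of positive integers, $\mathcal{C}(U)$ is the largest integer $k\ge1$ with $U=XY^k$ for strings $X,Y$, $Y$ nonempty; $\mathcal{C}^{(m)}(U)=\max\{m,\mathcal{C}(U)\}$. For $m\ge1$ the sequence $A^{(m)}=a^{(m)}(1),a^{(m)}(2),\ldots$ is given by $a^{(m)}(1)=m$, $a^{(m)}(i+1)=\mathcal{C}^{(m)}(a^{(m)}(1),\ldots,a^{(m)}(i))$. Fix $m$. Blocks and glue: $B_1^{(m)}=m$; for $n\ge1$, if $B_n^{(m)}$ is infinite then $B_{n+1}^{(m)}=B_n^{(m)}$ and $S_i^{(m)}=\emptyset$ for $i\ge n$; if $B_n^{(m)}$ is finite, let $s(1)=\mathcal{C}^{(m)}((B_n^{(m)})^{m+1})$, $s(i+1)=\mathcal{C}^{(m)}((B_n^{(m)})^{m+1}s(1)\ldots s(i))$; if some $i\ge1$ has $s(i+1)<m+1$, with $i$ least, $S_n^{(m)}=s(1),\ldots,s(i)$, otherwise $S_n^{(m)}=s(1),s(2),\ldots$ (infinite); and $B_{n+1}^{(m)}=(B_n^{(m)})^{m+1}S_n^{(m)}$. Terminating strings: if $S_1^{(m)},\ldots,S_{n-1}^{(m)}$ are finite, $T_{n+1}^{(m)}=S_1^{(m)}\cdots S_n^{(m)}$; if moreover $S_n^{(m)}$ is infinite,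 then $T_i^{(m)}=T_{n+1}^{(m)}$ for all $i\ge n+2$. *)

(* Defs.v *)
From mathcomp Require Import all_boot.
From mathcomp Require Import boolp.

Set Implicit Arguments.
Unset Strict Implicit.
Unset Printing Implicit Defensive.

(* [Inf f] is the infinite string f 0, f 1, f 2, ...: positions are counted
   from 0, so that the i-th term of an infinite string is [f i.-1]. *)
Inductive string : Type :=
| Fin of seq nat
| Inf of nat -> nat.

Definition scat (u v : string) : string :=
  match u, v with
  | Fin s, Fin t => Fin (s ++ t)
  | Fin s, Inf g =>
      Inf (fun i => if i < size s then nth 0 s i else g (i - size s))
  | Inf f, _ => Inf f
  end.

Definition spow (Y : seq nat) (k : nat) : seq nat := flatten (nseq k Y).

Definition ends_in_power (U : seq nat) (k : nat) : Prop :=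
  exists X Y : seq nat, Y <> [::] /\ U = X ++ spow Y k.

(* As Y is nonempty, U = X Y^k forces k <= size U: the range of the maximum
   loses nothing (see [curlingP]). The value on the empty string is junk. *)
Definition curling (U : seq nat) : nat :=
  \max_(1 <= k < (size U).+1 | `[< ends_in_power U k >]) k.

Definition curlingm (m : nat) (U : seq nat) : nat := maxn m (curling U).

(* The first n terms of s(1), s(2), ..., where s(1) = C^(m)(U) and
   s(i+1) = C^(m)(U s(1) ... s(i)). *)
Fixpoint ext_take (m : nat) (U : seq nat) (n : nat) : seq nat :=
  if n is n'.+1 then
    let s := ext_take m U n' in rcons s (curlingm m (U ++ s))
  else [::].

(* [ext m U i] is s(i+1). *)
Definition ext (m : nat) (U : seq nat) (i : nat) : nat :=
  curlingm m (U ++ ext_take m U i).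

(* [Aseq m i] is a^(m)(i+1). *)
Definition Aseq (m : nat) (i : nat) : nat :=
  if i is j.+1 then ext m [:: m] j else m.

(* The glue S_n as a function of the block B_n. *)
Definition glue_of (m : nat) (b : string) : string :=
  match b with
  | Inf _ => Fin [::]
  | Fin B =>
      let V := spow B m.+1 in
      match pselect (exists i, (1 <= i) && (ext m V i < m.+1)) with
      | left h => Fin (ext_take m V (ex_minn h))
      | right _ => Inf (ext m V)
      end
  end.

Definition next_block (m : nat) (b : string) : string :=
  match b with
  | Inf _ => b
  | Fin B => scat (Fin (spow B m.+1)) (glue_of m b)
  end.

(* [block m n] and [glue m n] are B_n^(m) and S_n^(m) for n >= 1; index 0 is
   junk. *)
Definition block (m n : nat) : string := iter n.-1 (next_block m) (Fin [:: m]).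

Definition glue (m n : nat) : string := glue_of m (block m n).

(* T_n^(m) = S_1^(m) ... S_{n-1}^(m) for n >= 2. Once some S_j is infinite,
   all T_i with i > j are equal, because [scat (Inf f) v = Inf f]. *)
Definition Tstr (m n : nat) : string :=
  \big[scat/Fin [::]]_(1 <= i < n) glue m i.

Definition prefix_of (u : seq nat) (f : nat -> nat) : Prop :=
  u = mkseq f (size u).

Lemma size_spow Y k : size (spow Y k) = k * size Y.
Proof. by rewrite size_flatten /shape map_nseq sumn_nseq mulnC. Qed.

Lemma ends_in_power_le U k : ends_in_power U k -> k <= size U.
Proof.
case=> X [[|y Y] [Y0 ->]]; first by case: Y0.
by rewrite size_cat size_spow (leq_trans (leq_pmulr k (ltn0Sn (size Y)))) ?leq_addl.
Qed.

Lemma curlingP U : U <> [::] ->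
  [/\ 1 <= curling U, ends_in_power U (curling U) &
      forall k, ends_in_power U k -> k <= curling U].
Proof.
move=> U0; have E1 : ends_in_power U 1.
  by exists [::], U; rewrite /spow /= cats0.
have le k : ends_in_power U k -> k <= curling U.
  case: k => // k Ek; have ks := ends_in_power_le Ek.
  rewrite /curling big_mkcond /=.
  rewrite (big_cat_nat (n := k.+1)) //=; last exact: ltnW.
  rewrite [X in maxn _ X]big_ltn //.
  by move/asboolP: Ek => ->; rewrite !leq_max leqnn orbT.
have c1 := le _ E1; split=> //.
suff: 1 <= curling U -> ends_in_power U (curling U) by apply.
rewrite /curling; apply: (big_ind (fun c => 1 <= c -> ends_in_power U c)).
- by [].
- by move=> x y Hx Hy; case: (leqP x y).
- by move=> i /asboolP.
Qed.

(* Main.v *)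
(* Write B_(n+1) = B_n^(m+1) S_n and T_n = S_1 ... S_(n-1), so that B_n ends in
   m T_n and T_n has no letter m. If a prefix of A^(m) ends in Y^k with m in Y, then
   k <= m+1: the string before the last m ends in a power with exponent k-1, so that
   m >= k-1. Hence curling numbers >= m+2 of B_n^(m+1) s(1) ... s(i)
   come from its suffix T_n s(1) ... s(i), where C^(m) and C^(m+1) therefore agree.

   This needs B_n^(m+1) to be a prefix of A^(m), which is proved along with the
   blocks: for U a prefix of B = B_n and 1 <= j <= m, a power Y^k with k > m at the
   end of B^j U that is not inside U is compared with the occurrences of T_n in B^j,
   which only end where a copy of B ends; shifting one by |Y| is impossible since
   (m+1)|B| exceeds the length of B^j U. When Y^k does not contain such an occurrence
   or cannot be shifted, the letter after U must exceed m anyway. *)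

Require Import Defs.
From mathcomp Require Import all_boot.
From HB Require Import structures.
From mathcomp Require Import boolp zify.

Set Implicit Arguments.
Unset Strict Implicit.
Unset Printing Implicit Defensive.

(** * Powers at the end of a string, read as periods *)

Definition periodic_on (f : nat -> nat) (lo hi p : nat) : Prop :=
  forall i, lo <= i -> i + p < hi -> f i = f (i + p).

Lemma periodic_onM f lo hi p t i : periodic_on f lo hi p ->
  lo <= i -> i + t * p < hi -> f i = f (i + t * p).
Proof.
move=> per lei; elim: t => [|t IH] lt; first by rewrite mul0n addn0.
rewrite mulSn in lt *.
rewrite IH; last by lia.
by rewrite per; [congr f|..]; lia.
Qed.

Lemma periodic_on_last f lo hi p i : 0 < p -> periodic_on f lo hi p ->
  lo <= i < hi -> exists j, [/\ i <= j, hi <= j + p, j < hi & f j = f i].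
Proof.
move=> p0 per /andP[]; have [n] := ubnP (hi - i).
elim: n i => // n IH i ltn loi ihi.
case: (leqP hi (i + p)) => [le|lt]; first by exists i.
have [|||j [ij hj jh fj]] := IH (i + p); try lia.
by exists j; split=> //; [lia|rewrite fj -per].
Qed.

(** For [k > 0] this encodes a final power [Y^k] with [Y] of length [p]; keeping only the length
    turns comparisons of powers into index arithmetic. *)
Definition power_at (U : seq nat) (p k : nat) : Prop :=
  [/\ 0 < p, k * p <= size U & periodic_on (nth 0 U) (size U - k * p) (size U) p].

Lemma nth_spow Y k i : i < k * size Y -> nth 0 (spow Y k) i = nth 0 Y (i %% size Y).
Proof.
elim: k i => // k IH i; rewrite mulSn => lt.
rewrite /spow /= nth_cat; case: ltnP => iY; first by rewrite modn_small.
rewrite -/(spow Y k) IH; last by lia.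
by rewrite -[in RHS](subnK iY) modnDr.
Qed.

Lemma ends_in_power_at U k : 0 < k ->
  ends_in_power U k <-> exists p, power_at U p k.
Proof.
move=> k0; split.
  case=> X [Y [Y0 ->]]; exists (size Y).
  have sY : 0 < size Y by case: Y Y0.
  rewrite /power_at size_cat size_spow; split=> //; first by lia.
  move=> i lei lti; rewrite !nth_cat.
  have -> : (i < size X) = false by lia.
  have -> : (i + size Y < size X) = false by lia.
  rewrite !nth_spow; [|lia..].
  by rewrite -addnBAC ?modnDr //; lia.
case=> p [p0 le per]; set n := size U - k * p in per.
exists (take n U), (take p (drop n U)); have pk : p <= k * p by rewrite leq_pmull.
have sY : size (take p (drop n U)) = p by rewrite size_takel // size_drop; lia.
split; first by move=> Y0; rewrite Y0 /= in sY; lia.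
rewrite -[LHS](cat_take_drop n); congr cat.
have sz : size (drop n U) = k * p by rewrite size_drop; lia.
apply: (@eq_from_nth _ 0); first by rewrite size_spow sY.
move=> i; rewrite sz => lti; rewrite nth_spow sY // nth_take ?ltn_mod //.
rewrite !nth_drop [in LHS](divn_eq i p) addnCA addnC.
rewrite -(periodic_onM per) //; first by lia.
by have := divn_eq i p; lia.
Qed.

Lemma power_at_le U p k l : l <= k -> power_at U p k -> power_at U p l.
Proof.
move=> lk [p0 le per]; have lp : l * p <= k * p by rewrite leq_mul2r lk orbT.
by split=> //; [lia | move=> i h1 h2; apply: per; lia].
Qed.

Lemma curling_nil : curling [::] = 0.
Proof. by rewrite /curling big_geq. Qed.

Lemma curling_geP U k : 0 < k -> k <= curling U <-> exists p, power_at U p k.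
Proof.
move=> k0; case: (eqVneq U [::]) => [->|/eqP U0].
  rewrite curling_nil; split=> [|[p [p0 /= + _]]]; first by lia.
  by have : 0 < k * p by [rewrite muln_gt0 k0]; lia.
have [c1 Ec cmax] := curlingP U0; split=> [le|].
  have /ends_in_power_at [//|p hp] := Ec.
  by exists p; apply: power_at_le le hp.
by move=> hp; apply: cmax; apply/ends_in_power_at.
Qed.

Lemma power_at_curling U p k : power_at U p k -> k <= curling U.
Proof. by case: k => // k hp; apply/curling_geP => //; exists p. Qed.

Lemma power_at_drop n U p k : power_at (drop n U) p k -> power_at U p k.
Proof.
case; rewrite size_drop => p0 le per; split=> //; first by lia.
move=> i lei lti; have h : n <= size U by lia.
have := per (i - n); rewrite !nth_drop.
have -> : n + (i - n) = i by lia.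
have -> : n + (i - n + p) = i + p by lia.
by apply; lia.
Qed.

Lemma power_at_suffix n U p k : n + k * p <= size U ->
  power_at U p k -> power_at (drop n U) p k.
Proof.
move=> le [p0 _ per]; split=> //; rewrite size_drop; first by lia.
by move=> i lei lti; rewrite !nth_drop addnA per //; lia.
Qed.

Lemma curling_drop n U : curling (drop n U) <= curling U.
Proof.
case E : (curling (drop n U)) => [//|c].
have [p hp] : exists p, power_at (drop n U) p c.+1 by apply/curling_geP; rewrite ?E.
exact: power_at_curling (power_at_drop hp).
Qed.

(** * Strings generated by the curling rule *)

(* The junk value [curling [::] = 0] makes the first letter of a generated
   string equal to [m]. *)
Definition generated (m : nat) (U : seq nat) : Prop :=
  forall i, i < size U -> nth 0 U i = curlingm m (take i U).

Lemma generated_rcons m U x :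
  generated m (rcons U x) <-> generated m U /\ x = curlingm m U.
Proof.
split=> [g|[g ->] i].
  split=> [i lt|].
    have := g i; rewrite size_rcons nth_rcons lt -cats1 takel_cat; last by lia.
    by apply; lia.
  have := g (size U); rewrite size_rcons nth_rcons ltnn eqxx -cats1 take_size_cat //.
  by apply.
rewrite size_rcons ltnS leq_eqVlt => /predU1P[->|lt].
  by rewrite nth_rcons ltnn eqxx -cats1 take_size_cat.
by rewrite nth_rcons lt -cats1 takel_cat ?g //; lia.
Qed.

(* What precedes the last [m] of the power ends in a power with exponent
   [k.-1]. *)
Lemma power_at_min m U p k i : generated m U -> power_at U p k ->
  size U - k * p <= i < size U -> nth 0 U i = m -> k <= m.+1.
Proof.
move=> g [p0 le per] bnd fi; have [j [ij hj jU fj]] := periodic_on_last p0 per bnd.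
case: k => // k in le per bnd *; rewrite mulSn in le per bnd.
have : power_at (take j U) p k.
  set N := k * p in le per bnd *.
  rewrite /power_at -/N size_takel; last exact: ltnW.
  split=> //; first by lia.
  move=> x lx xl; rewrite !nth_take; [|lia..].
  by apply: per; lia.
move/power_at_curling; have := g j jU; rewrite fj fi /curlingm; lia.
Qed.

(** * Blocks whose power [B^(m+1)] is again generated *)

(* In the infinite power of [B], [R] consecutive letters other than [m] can only
   end where a copy of [B] ends. *)
Definition runs_end (m : nat) (B : seq nat) (R : nat) : Prop :=
  forall e, R <= e -> (forall i, e - R <= i < e -> nth 0 B (i %% size B) <> m) ->
  size B %| e.

(* [take c B] plays the role of an earlier block B_i with terminating string of
   length [R]: every prefix of [B] followed by [m] is B_i, or ends in B_i preceded
   by a longer run of letters other than [m]; moreover B itself ends in B_i B_i t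
   where t, of length [d], avoids [m]. This holds for the blocks when m = 1. *)
Definition peelable (m : nat) (B : seq nat) : Prop :=
  forall r, 0 < r < size B -> nth 0 B r = m -> exists c R d,
  [/\ 0 < c <= r, R < c, 0 < d & d + 2 * c <= size B] /\
  [/\ nth 0 B (c - R.+1) = m,
      forall x, x < c -> nth 0 B (r - c + x) = nth 0 B x &
      r = c \/ c + R < r /\ (forall y, y <= R -> nth 0 B (r - c - y.+1) <> m)] /\
  [/\ forall x, x < c -> nth 0 B (size B - d - c + x) = nth 0 B x,
      forall x, x < c -> nth 0 B (size B - d - 2 * c + x) = nth 0 B x,
      forall y, y < R -> nth 0 B (c - y.+1) <> m &
      forall y, y < d -> nth 0 B (size B - y.+1) <> m].

(** [R] stands for the length of the terminating string. [rep_peel] serves the one case, a square,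
    that shifting by a period leaves open. *)
Record repeatable (m : nat) (B : seq nat) (R : nat) : Prop := Repeatable {
  rep_gen : generated m B;
  rep_size : R < size B;
  rep_head : nth 0 B 0 = m;
  rep_curling : curling B <= m;
  rep_tail : forall y, y < R -> nth 0 B (size B - y.+1) <> m;
  rep_before : nth 0 B (size B - R.+1) = m;
  rep_runs : runs_end m B R;
  rep_peel : m = 1 -> peelable m B }.

(* The hypotheses on [p] and [r] say that [B ++ take r B] ends in a square tUtU with
   U = take r B and t a suffix of [B] avoiding 1. If U is the block B_i of
   [peelable], then B ends in t t; otherwise the letters before the last B_i in U
   contradict those in B_i B_i t. *)
Lemma peelable_no_square B R p r :
  curling B <= 1 -> (forall y, y < R -> nth 0 B (size B - y.+1) <> 1) ->
  peelable 1 B -> r < size B -> 0 < r < p -> p - r <= R -> 2 * p <= size B + r ->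
  (forall i, size B + r - 2 * p <= i -> i + p < size B ->
     nth 0 B i = nth 0 B (i + p)) ->
  (forall x, x < r -> nth 0 B (size B - p + x) = nth 0 B x) ->
  nth 0 B r <> 1.
Proof.
move=> cB tail peel rb rp prR pb per suf Br.
have [|c [R' [d [[cr R'c d0 dcb] [[fR suf_c alt] [end1 end2 tail_c tail_d]]]]]] :=
  peel r _ Br; first by lia.
set b := size B in cB tail rb pb per suf dcb end1 end2 tail_d.
set f := nth 0 B in tail per suf fR suf_c alt end1 end2 tail_c tail_d.
(* The last 1 of [B] is located twice, through [end1] and through [suf]; comparing the two positions
   gives [d = p - r]. *)
have fd : f (b - d - R'.+1) = 1.
  by rewrite (_ : _ - R'.+1 = b - d - c + (c - R'.+1)) ?end1 //; lia.
have nd y : y < d + R' -> f (b - y.+1) <> 1.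
  move=> yd; have [lt|ge] := ltnP y d; first exact: tail_d.
  rewrite (_ : b - y.+1 = b - d - c + (c - (y - d).+1)); last by lia.
  by rewrite end1; [apply: tail_c|]; lia.
have fp : f (b - (p - r) - R'.+1) = 1.
  rewrite (_ : _ - R'.+1 = b - p + (r - c + (c - R'.+1))); last by lia.
  by rewrite suf ?suf_c //; lia.
have np y : y < p - r + R' -> f (b - y.+1) <> 1.
  move=> yd; have [lt|ge] := ltnP y (p - r); first by apply: tail; lia.
  rewrite (_ : b - y.+1 = b - p + (r - c + (c - (y - (p - r)).+1))); last by lia.
  by rewrite suf ?suf_c; [apply: tail_c|..]; lia.
have dE : d = p - r.
  have [lt|lt|//] := ltngtP d (p - r).
    by case: (np (d + R')); [lia|rewrite -fd; congr f; lia].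
  by case: (nd (p - r + R')); [lia|rewrite -fp; congr f; lia].
have fm : f (b - d - c - R'.+1) = 1.
  by rewrite (_ : _ - R'.+1 = b - d - 2 * c + (c - R'.+1)) ?end2 //; lia.
case: alt => [rc|[cR'r alt]]; last first.
  case: (alt R') => //; rewrite -fm (_ : b - d - c - R'.+1 = b - p + (r - c - R'.+1)).
    by rewrite suf //; lia.
  by lia.
(* Now [p = c + d], so the shift by [p] takes the 1 of [fm] to position [b - R'.+1], which must lie
   outside the last [d] letters. *)
have dR : d <= R'.
  rewrite leqNgt; apply/negP => lt; case: (tail_d R') => //.
  by rewrite -fm [RHS]per; [congr f|..]; lia.
suff /power_at_curling : power_at B d 2 by lia.
split=> //; first by lia.
rewrite -/b => i bi ib.
rewrite -/f (_ : i = b - d - c + (i + c + d - b)); last by lia.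
rewrite end1; last by lia.
rewrite -end2; last by lia.
by rewrite per; [congr f|..]; lia.
Qed.

(** As [take r B] is a suffix of the longer prefix, only a power with exponent above [m] that starts
    before this suffix can matter. It is either impossible or has exponent [m+1] and forces the next
    letter above [m]. *)
Lemma repeat_letter m B R j r : 0 < m -> repeatable m B R ->
  r < size B -> 0 < j <= m ->
  generated m (take (j * size B + r) (spow B m.+1)) ->
  nth 0 B r = curlingm m (take (j * size B + r) (spow B m.+1)).
Proof.
move=> m0 [gB Rb head cB tail before runs peel] rb jm.
set b := size B in rb runs tail before *; set e := j * b + r.
set P := take e _ => gP.
have eb : e < m.+1 * b.
  have : j * b <= m * b by rewrite leq_mul2r; have /andP[_ ->] := jm; rewrite orbT.
  by rewrite /e mulSn; lia.
have sP : size P = e by rewrite size_takel // size_spow; lia.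
have nP i : i < e -> nth 0 P i = nth 0 B (i %% b).
  by move=> lt; rewrite nth_take // nth_spow //; lia.
have bj : b <= j * b by rewrite leq_pmull //; lia.
have nP0 x : x < r -> nth 0 P (j * b + x) = nth 0 B x.
  by move=> lt; rewrite nP; [rewrite modnMDl modn_small //|]; lia.
have nP1 x : x < b -> nth 0 P (j * b - b + x) = nth 0 B x.
  move=> lt; rewrite nP; last by lia.
  by rewrite -[in X in _ - X](mul1n b) -mulnBl modnMDl modn_small.
have dP : drop (j * b) P = take r B.
  have sd : size (drop (j * b) P) = r by rewrite size_drop sP /e addKn.
  apply: (@eq_from_nth _ 0); first by rewrite sd size_takel // ltnW.
  by rewrite sd => i lt; rewrite nth_drop nth_take // nP0.
rewrite (gB _ rb); apply/eqP; rewrite /curlingm eqn_leq !geq_max !leq_maxl /=.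
rewrite !leq_max -dP curling_drop orbT /= dP -leq_max.
have := curling_geP P; set k := curling P => kP.
have [|km] := leqP k m; first by rewrite leq_max => ->.
have [p hp] : exists p, power_at P p k by apply/kP; lia.
have [p0 Ne per] := hp; rewrite sP in Ne per.
have kmin i := @power_at_min _ _ _ _ i gP hp; rewrite sP in kmin.
(* Otherwise [b] divides [p], and the power would be at least as long as [B^(m+1)]. *)
have noshift x : b %| x -> ~ b %| x + p.
  move=> bx; rewrite dvdn_addr // => /(dvdn_leq p0) bp.
  by have : m.+1 * b <= k * p by [exact: leq_mul]; lia.
have N2 : 2 * p <= k * p by rewrite leq_mul2r; lia.
have Nk1 : k = 2 \/ 3 * p <= k * p.
  by case: (ltngtP k 2) => [||->]; [lia|right; rewrite leq_mul2r; lia|left].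
have eE : e = j * b + r by [].
have Bb : size B = b by [].
have [N NE] : exists N, N = k * p by exists (k * p).
have [s sE] : exists s, s = j * b by exists (j * b).
rewrite -?NE -?sE in eE bj nP0 nP1 dP Ne per kmin N2 Nk1.
clearbody b e P k; clear eb.
have {}gB i : i < b -> nth 0 B i = curlingm m (take i B) by rewrite -Bb; exact: gB.
have dvd_s x : x = s -> b %| x by move=> ->; rewrite sE dvdn_mull.
have winP e' : R <= e' -> e' <= e ->
    (forall i, e' - R <= i < e' -> nth 0 P i <> m) -> b %| e'.
  move=> Re' e'e h; rewrite -Bb; apply: (runs _ Re') => i hi.
  have := h i hi; rewrite Bb nP //; by case/andP: hi => _ /leq_trans ->.
have tailP i : s - R <= i < s -> nth 0 P i <> m.
  move=> hi; rewrite (_ : i = s - b + (b - (s - i.+1).+1)); last by lia.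
  by rewrite nP1; [apply: tail|]; lia.
rewrite leq_max; apply/orP; right.
have [Nr|rN] := leqP N r.
  rewrite -dP; apply: power_at_curling (power_at_suffix _ hp).
  by rewrite sP -NE; lia.
(* For [r = 0] the string is [B^j]. A power within the last [B] contradicts [curling B <= m]; a
   longer one contains the head of that [B], so [R < p], and the final run can be shifted back by
   [p]. *)
have [r0|r0] := posnP r.
  exfalso; have ej : e = s by rewrite eE r0 addn0.
  have [Nb|bN] := leqP N b.
    have dB : drop (e - b) P = B.
      have sd : size (drop (e - b) P) = b by rewrite size_drop sP; lia.
      apply: (@eq_from_nth _ 0); first by rewrite sd Bb.
      by rewrite sd => i lt; rewrite nth_drop ej nP1.
    suff /power_at_curling : power_at B p k by lia.
    by rewrite -[B]dB; apply: power_at_suffix; rewrite // sP -NE; lia.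
  have [|i [ii ip ie fi]] := @periodic_on_last _ _ _ _ (e - b) p0 per; first by lia.
  have fb : nth 0 P (e - b) = m by rewrite ej -[_ - _]addn0 nP1 //; lia.
  have Rp : R < p.
    rewrite ltnNge; apply/negP => pR; apply: (tailP i); last by rewrite fi.
    by lia.
  have bdp : b %| e - p.
    by apply: winP => [||x hx]; [lia..|rewrite per; [apply: tailP|..]; lia].
  by apply: (noshift _ bdp); apply: dvd_s; lia.
have Pj : nth 0 P s = m by rewrite -[s]addn0 nP0.
have -> : k = m.+1 by have := kmin s; rewrite Pj; lia.
suff Br : nth 0 B r <> m.
  by have := gB r rb; rewrite /curlingm; lia.
(* [q] counts the letters of the power that precede the last, partial copy of [B]. *)
move=> Br; set q := N - r.
have [Rq|qR] := leqP R q; last first.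
  (* The period starts with [q] letters other than [m], so it is a rotation of a
     period of [take r B], and the power that forces the letter after the prefix
     of length [p - q] occurs again at the end of [take r B]. *)
  have qp : q < p.
    rewrite ltnNge; apply/negP => pq; apply: (tailP (s - p)); first by lia.
    by rewrite per; [rewrite subnK // | |]; lia.
  have pr : p <= r by lia.
  have Bc : nth 0 B (p - q) <> m.
    rewrite -nP0; last by lia.
    rewrite (_ : s + (p - q) = s - q + p); last by lia.
    by rewrite -per; [apply: tailP|..]; lia.
  have suf : drop (r - (p - q)) (take r B) = take (p - q) B.
    have sd : size (drop (r - (p - q)) (take r B)) = p - q.
      by rewrite size_drop size_takel; lia.
    apply: (@eq_from_nth _ 0); first by rewrite sd size_takel //; lia.
    rewrite sd => x xc; rewrite nth_drop !nth_take; [|lia..].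
    rewrite -!nP0; [|lia..].
    have rE : r - (p - q) = k.-1 * p.
      by rewrite /q NE; case: (k) km NE => // k' _; rewrite mulSn /=; lia.
    by rewrite (addnC _ x) addnA rE -(periodic_onM per) //; lia.
  have := curling_drop (r - (p - q)) (take r B); rewrite suf.
  have := gB (p - q); have := gB r; rewrite Br /curlingm; lia.
(* For [p <= r] the run ending at [s] shifts right by [p]; otherwise a shift to the left is tried,
   which needs [p + R <= q]. *)
have [pr|rp] := leqP p r.
  have bdp : b %| s + p.
    apply: winP => [||x hx]; [lia..|].
    rewrite (_ : x = x - p + p); last by lia.
    by rewrite -per; [apply: tailP|..]; lia.
  exact: noshift (dvd_s _ erefl) bdp.
have Pjp : nth 0 P (s - p) = m.
  by rewrite per; [rewrite subnK //| |]; lia.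
have Rp : R < p.
  by rewrite ltnNge; apply/negP => pR; apply: (tailP (s - p)); lia.
have [pRq|qpR] := leqP (p + R) q.
  have bdp : b %| s - p.
    by apply: winP => [||x hx]; [lia..|rewrite per; [apply: tailP|..]; lia].
  by apply: (noshift _ bdp); apply: dvd_s; lia.
(* A square with [R] letters in its middle is the only power in which those
   letters cannot be shifted by a period. *)
have k2 : k = 2 by lia.
have {}k2 : N = 2 * p by rewrite NE k2.
have m1 : m = 1 by lia.
have j1 : j = 1 by lia.
rewrite m1 in cB tail peel Br; have {}sE : s = b by rewrite sE j1 mul1n.
rewrite sE in nP0 eE.
apply: (@peelable_no_square B R p r) Br; rewrite ?Bb //; try lia.
- exact: peel.
- move=> i bi ib; have := per i; rewrite !nP; [|lia..].
  by rewrite !modn_small; [|lia..]; apply; lia.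
- move=> x xr; rewrite -[RHS]nP0 // (_ : b + x = b - p + x + p); last by lia.
  by rewrite -per; [rewrite nP ?modn_small|..]; lia.
Qed.

Lemma repeat_generated m B R : 0 < m -> repeatable m B R ->
  generated m (spow B m.+1).
Proof.
move=> m0 repB; set V := spow B m.+1; rewrite -[V]take_size.
have b0 : 0 < size B by have := rep_size repB; lia.
suff gen e : e <= size V -> generated m (take e V) by exact: gen.
elim: e => [|e IH] eV; first by rewrite take0.
rewrite (take_nth 0) //; apply/generated_rcons.
have gV := IH (ltnW eV); split=> //.
rewrite size_spow in eV; rewrite nth_spow //.
have eE := divn_eq e (size B); have rb : e %% size B < size B by rewrite ltn_mod.
have [j0|j0] := posnP (e %/ size B).
  rewrite j0 mul0n add0n in eE; rewrite -eE in rb *; rewrite (rep_gen repB) //.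
  have -> : V = B ++ spow B m by [].
  by rewrite takel_cat // ltnW.
have jm : e %/ size B <= m by rewrite -ltnS ltn_divLR.
rewrite [in RHS]eE; apply: (repeat_letter m0 repB rb); first by rewrite j0.
by rewrite -eE.
Qed.

Lemma spowSr Y k : spow Y k.+1 = spow Y k ++ Y.
Proof. by rewrite /spow -addn1 nseqD flatten_cat /= cats0. Qed.

Lemma repeatable_seq1 m : 0 < m -> repeatable m [:: m] 0.
Proof.
move=> m0; have [//|_ /ends_in_power_le c1 _] := @curlingP [:: m].
split=> //.
- by case=> // _; rewrite /curlingm curling_nil maxn0.
- exact: leq_trans c1 m0.
- by move=> m1 r /= r0; lia.
Qed.

Lemma repeatable_next m B R S : 0 < m -> repeatable m B R ->
  0 < size S -> all (ltn m) S -> generated m (spow B m.+1 ++ S) ->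
  curling (spow B m.+1 ++ S) <= m ->
  repeatable m (spow B m.+1 ++ S) (R + size S).
Proof.
move=> m0 repB S0 allS gB' cB'.
have [gB Rb head cB tail before runs peel] := repB.
have [b bE] : exists b, size B = b by exists (size B).
have [s sE] : exists s, size S = s by exists (size S).
have [v vE] : exists v, v = m * b by exists (m * b).
rewrite bE in Rb tail before; rewrite sE in S0 *.
have [B' B'E] : exists B', B' = spow B m.+1 ++ S by exists (spow B m.+1 ++ S).
rewrite -B'E in gB' cB' *.
have sB' : size B' = v + b + s by rewrite B'E size_cat size_spow mulSn bE sE; lia.
have nB' x : x < v + b -> nth 0 B' x = nth 0 B (x %% b).
  by move=> xv; rewrite B'E nth_cat size_spow bE mulSn addnC -vE xv nth_spow bE ?mulSn; lia.
have headB' : nth 0 B' 0 = m by rewrite nB' ?mod0n; lia.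
have nB'v x : x < b -> nth 0 B' (v + x) = nth 0 B x.
  by move=> xb; rewrite nB' ?vE ?modnMDl ?modn_small //; lia.
have tailS y : y < s -> nth 0 B' (v + b + s - y.+1) <> m.
  move=> ys; rewrite B'E nth_cat size_spow bE mulSn -vE.
  have -> : (v + b + s - y.+1 < b + v) = false by lia.
  have /(allP allS) /= : nth 0 S (v + b + s - y.+1 - (b + v)) \in S.
    by rewrite mem_nth // sE; lia.
  by lia.
split=> //; rewrite ?sB' //; first by lia.
- move=> y yR; have [ys|sy] := ltnP y s; first exact: tailS.
  rewrite (_ : v + b + s - y.+1 = v + (b - (y - s).+1)); last by lia.
  by rewrite nB'v; [apply: tail|]; lia.
- rewrite (_ : v + b + s - (R + s).+1 = v + (b - R.+1)); last by lia.
  by rewrite nB'v //; lia.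
- move=> e Re win; set b' := size B'.
  have b'0 : 0 < b' by rewrite /b' sB'; lia.
  have [r0|r0] := posnP (e %% b'); first by rewrite /dvdn r0.
  have eE := divn_eq e b'; have rb' : e %% b' < b' by rewrite ltn_mod.
  exfalso; move: eE r0 rb'; set c := e %/ b' * b'; set r := e %% b' => eE r0 rb'.
  have winr i : e - (R + s) <= c + i < e -> i < b' -> nth 0 B' i <> m.
    by move=> hi ib; have := win _ hi; rewrite /c modnMDl modn_small.
  (* The run cannot cross the head [m] of a copy of [B']. Without its last [s] letters it ends where
     a copy of [B] ends, and the next letter, still in the run, would be a head [m]. *)
  have Rr : R + s < r.
    rewrite ltnNge; apply/negP => le; apply: (winr 0) => //.
    by clearbody c r b'; lia.
  have b'E : b' = v + b + s by [].
  have wx : nth 0 B' (r - s) <> m by apply: winr; clearbody c r b'; lia.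
  have bx : b %| r - s.
    rewrite -bE; apply: runs; first by clearbody c r b'; lia.
    move=> i hi; rewrite bE -nB'; last by clearbody c r b'; lia.
    by apply: winr; clearbody c r b'; lia.
  apply: wx; rewrite nB'; last by clear bx; clearbody c r b'; lia.
  by move: bx; rewrite /dvdn => /eqP ->.
- move=> m1 r; rewrite sB' => rb' Br.
  have {}vE : v = b by rewrite vE m1 mul1n.
  rewrite vE in nB' nB'v tailS rb' sB' *.
  have nB0 x : x < b -> nth 0 B' x = nth 0 B x.
    by move=> xb; rewrite nB' ?modn_small //; lia.
  have {}peel := peel m1; rewrite /peelable bE in peel.
  have r2 : r < b + b.
    rewrite ltnNge; apply/negP => le; apply: (tailS (b + b + s - r.+1)); first by lia.
    by rewrite -[RHS]Br; congr nth; lia.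
  (* Here [B' = B B S]. Inside either copy the witnesses for [B] are kept, with [d] extended by [S];
     at [r = b] the block [B] itself is the witness. *)
  have [rb|rb|rb] := ltngtP r b.
  + have [||c [R' [d [[cr R'c d0 dcb] [[fR suf alt] [end1 end2 tc td]]]]]] := peel r; first by lia.
      by rewrite -nB0.
    exists c, R', (d + s); split; first by split; lia.
    split; [split|split].
    * by rewrite nB0 //; lia.
    * by move=> x xc; rewrite !nB0 ?suf //; lia.
    * case: alt => [->|[lt alt]]; [by left|right; split=> // y yR].
      by rewrite nB0; [apply: alt|lia].
    * move=> x xc; rewrite (_ : _ + x = b + (b - d - c + x)); last by lia.
      by rewrite nB'v ?nB0 ?end1 //; lia.
    * move=> x xc; rewrite (_ : _ + x = b + (b - d - 2 * c + x)); last by lia.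
      by rewrite nB'v ?nB0 ?end2 //; lia.
    * by move=> y yR; rewrite nB0; [apply: tc|lia].
    * move=> y yd; have [ys|sy] := ltnP y s; first exact: tailS.
      rewrite (_ : b + b + s - y.+1 = b + (b - (y - s).+1)); last by lia.
      by rewrite nB'v; [apply: td|]; lia.
  + have [||c [R' [d [[cr R'c d0 dcb] [[fR suf alt] [end1 end2 tc td]]]]]] := peel (r - b); first by lia.
      by rewrite -nB'v ?subnKC //; lia.
    exists c, R', (d + s); split; first by split; lia.
    split; [split|split].
    * by rewrite nB0 //; lia.
    * move=> x xc; rewrite (_ : r - c + x = b + (r - b - c + x)); last by lia.
      by rewrite nB'v ?nB0 ?suf //; lia.
    (* If [r - b = c], the end of the first [B] precedes, and its run of [d + R'] letters is longer
       than [R']. *)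
    * right; split; first by lia.
      move=> y yR; case: alt => [rc|[lt alt]]; last first.
        rewrite (_ : r - c - y.+1 = b + (r - b - c - y.+1)); last by lia.
        by rewrite nB'v; [apply: alt|lia].
      rewrite (_ : r - c - y.+1 = b - y.+1) ?nB0; [|lia..].
      have [yd|dy] := ltnP y d; first exact: td.
      rewrite (_ : b - y.+1 = b - d - c + (c - (y - d).+1)); last by lia.
      by rewrite end1; [apply: tc|]; lia.
    * move=> x xc; rewrite (_ : _ + x = b + (b - d - c + x)); last by lia.
      by rewrite nB'v ?nB0 ?end1 //; lia.
    * move=> x xc; rewrite (_ : _ + x = b + (b - d - 2 * c + x)); last by lia.
      by rewrite nB'v ?nB0 ?end2 //; lia.
    * by move=> y yR; rewrite nB0; [apply: tc|lia].
    * move=> y yd; have [ys|sy] := ltnP y s; first exact: tailS.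
      rewrite (_ : b + b + s - y.+1 = b + (b - (y - s).+1)); last by lia.
      by rewrite nB'v; [apply: td|]; lia.
  + exists b, R, s; split; first by split; lia.
    split; [split|split].
    * by rewrite nB0 //; lia.
    * by move=> x xc; rewrite rb subnn.
    * by left.
    * by move=> x xc; rewrite [RHS]nB0 // -nB'v //; congr nth; lia.
    * by move=> x xc; congr nth; lia.
    * by move=> y yR; rewrite nB0; [apply: tail|lia].
    * by move=> y yd; apply: tailS.
Qed.

(** * From [A^(m)] to [A^(m+1)] *)

(** A maximal power that fits in [G] is seen by [G]; any other contains the displayed [m], so its
    exponent is exactly [m+1], the floor of [curlingm m.+1]. *)
Lemma curlingm_promote m D G : generated m (D ++ m :: G) ->
  m < curlingm m (D ++ m :: G) ->
  curlingm m (D ++ m :: G) = curlingm m.+1 G.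
Proof.
set W := D ++ m :: G => gW; rewrite /curlingm leq_max ltnn /= => mc.
have GE : G = drop (size D).+1 W by rewrite /W -cat_rcons drop_size_cat ?size_rcons.
have sW : size W = size D + (size G).+1 by rewrite /W size_cat.
have [p hp] : exists p, power_at W p (curling W) by apply/curling_geP; lia.
have := curling_drop (size D).+1 W; rewrite -GE.
have [le|lt] := leqP (curling W * p) (size G).
  have := @power_at_suffix (size D).+1 W p (curling W).
  rewrite -GE sW; move=> /(_ _ hp) suf.
  have := power_at_curling (suf _); lia.
have := @power_at_min _ _ _ _ (size D) gW hp.
have -> : nth 0 W (size D) = m by rewrite /W nth_cat ltnn subnn.
by rewrite sW; lia.
Qed.

Lemma size_ext_take m U n : size (ext_take m U n) = n.
Proof. by elim: n => //= n IH; rewrite size_rcons IH. Qed.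

Lemma nth_ext_take m U n i : i < n -> nth 0 (ext_take m U n) i = ext m U i.
Proof.
elim: n => // n IH; rewrite ltnS leq_eqVlt /= nth_rcons size_ext_take.
by case/predU1P=> [->|lt]; [rewrite ltnn eqxx|rewrite lt IH].
Qed.

Lemma generated_ext_take m U n : generated m U -> generated m (U ++ ext_take m U n).
Proof.
move=> gU; elim: n => [|n IH] /=; first by rewrite cats0.
by rewrite -rcons_cat; apply/generated_rcons.
Qed.

Lemma ext_take_promote m D T n : generated m (D ++ m :: T) -> generated m.+1 T ->
  (forall i, i < n -> m < ext m (D ++ m :: T) i) ->
  generated m.+1 (T ++ ext_take m (D ++ m :: T) n) /\
  all (ltn m) (ext_take m (D ++ m :: T) n).
Proof.
move=> gV gT; elim: n => [|n IH] big /=; first by rewrite cats0.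
have [gn an] := IH (fun i lt => big i (ltnW lt)).
rewrite all_rcons an -rcons_cat; have lt := big n (leqnn _).
split; last by rewrite /= andbT.
apply/generated_rcons; split=> //.
have := @generated_ext_take _ _ n gV; move: lt; rewrite /ext -catA /= => lt gVn.
exact: curlingm_promote.
Qed.

Lemma AseqE m i : Aseq m i = curlingm m (mkseq (Aseq m) i).
Proof.
case: i => [|i]; first by rewrite /curlingm curling_nil maxn0.
rewrite /= /ext; congr curlingm.
elim: i => [//|i IH]; rewrite mkseqS -IH /= /ext.
by rewrite -cat1s.
Qed.

Lemma generated_prefix_of m U : generated m U -> prefix_of U (Aseq m).
Proof.
rewrite /prefix_of; elim/last_ind: U => // U x IH /generated_rcons[/IH UE ->].
by rewrite size_rcons mkseqS AseqE -UE.
Qed.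

(** * Concatenation of possibly infinite strings, and the invariant *)

Lemma scatA : associative scat.
Proof.
case=> [u|f] [v|g] [w|h] //=; first by rewrite catA.
congr Inf; apply/funext => i; rewrite size_cat nth_cat.
by case: ltnP => iu; [rewrite ifT //; lia|rewrite subnDA; case: ltnP => ?; case: ltnP => ?; lia].
Qed.

Lemma scat0s : left_id (Fin [::]) scat.
Proof. by case=> //= f; congr Inf; apply/funext => i; rewrite subn0. Qed.

Lemma scats0 : right_id (Fin [::]) scat.
Proof. by case=> //= s; rewrite cats0. Qed.

HB.instance Definition _ := SemiGroup.isLaw.Build string scat scatA.
HB.instance Definition _ :=
  Monoid.isMonoidLaw.Build string (Fin [::]) scat scat0s scats0.

Lemma TstrS m n : 0 < n -> Tstr m n.+1 = scat (Tstr m n) (glue m n).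
Proof. by move=> n0; rewrite /Tstr big_nat_recr. Qed.

(** [T] is what follows the last [m] of the block: [repeatable] lets the blocks continue,
    [generated m.+1 T] yields the theorem. *)
Definition stage (m : nat) (b t : string) : Prop :=
  match b with
  | Fin B => exists D T, [/\ B = D ++ m :: T, t = Fin T, repeatable m B (size T)
                          & generated m.+1 T]
  | Inf _ => t = Inf (Aseq m.+1)
  end.

Lemma stage_next m b t : 0 < m -> stage m b t ->
  stage m (next_block m b) (scat t (glue_of m b)).
Proof.
move=> m0; case: b => [B|f] /=; last by move->.
case=> D [T [BE -> repB gT]]; have gV := repeat_generated m0 repB.
set V := spow B m.+1 in gV *.
have VE : V = (spow B m ++ D) ++ m :: T by rewrite /V spowSr BE -catA.
(* [glue_of] searches from index 1 only; at index 0 the string is itself an [(m+1)]-st power. *)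
have big0 : m < ext m V 0.
  rewrite /ext /= cats0 /curlingm leq_max; apply/orP; right.
  have B0 : B <> [::] by rewrite BE; case: (D).
  apply/curling_geP => //; apply/ends_in_power_at => //.
  by exists [::], B.
have promote n : (forall i, i < n -> m < ext m V i) ->
    generated m.+1 (T ++ ext_take m V n) /\ all (ltn m) (ext_take m V n).
  by rewrite VE in gV * => big; apply: ext_take_promote.
case: pselect => [h|big] /=.
  case: ex_minnP => n /andP[n0 small] nmin.
  have big i : i < n -> m < ext m V i.
    case: i => // i; rewrite [in X in X -> _]ltnNge => /negP lt.
    by rewrite ltnNge; apply/negP => le; apply: lt; apply: nmin.
  have [gTS allS] := promote n big.
  exists (spow B m ++ D), (T ++ ext_take m V n); split=> //.
    by rewrite {1}VE -catA.
  rewrite size_cat; apply: repeatable_next => //.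
  - by rewrite size_ext_take.
  - exact: generated_ext_take.
  (* The value that stops the glue bounds the curling number of the new block. *)
  - by move: small; rewrite ltnS /ext /curlingm geq_max => /andP[].
have {}big i : m < ext m V i.
  case: i => // i; rewrite ltnNge; apply/negP => le.
  by apply: big; exists i.+1; rewrite ltnS.
congr Inf; apply/funext => i; have [gTS _] := promote i.+1 (fun i _ => big i).
have := congr1 (fun s => nth 0 s i) (generated_prefix_of gTS).
rewrite nth_mkseq; last by rewrite size_cat size_ext_take; lia.
move=> <-; rewrite nth_cat; case: ltnP => // le.
by rewrite nth_ext_take // ltnS leq_subr.
Qed.

Theorem theorem1 (m n : nat) (hm : 1 <= m) (hn : 2 <= n) :
  match Tstr m n with
  | Fin u => prefix_of u (Aseq m.+1)
  | Inf f => f = Aseq m.+1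
  end.
Proof.
have : stage m (block m n) (Tstr m n).
  case: n hn => // n _; elim: n => [|n IH].
    exists [::], [::]; split=> //; last exact: repeatable_seq1.
    by rewrite /Tstr big_geq.
  by rewrite TstrS //; apply: stage_next.
case: (block m n) => [B [D [T [_ -> _ gT]]]|f ->] //.
exact: generated_prefix_of.
Qed.
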